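(* Let $\mathcal{B}$ be a complex matrix $\ast$-algebra with basis $R_1,\ldots,R_s$, let $n\ge1$, let $\mathcal{A}:=\mathrm{Sym}^n(\mathcal{B})$ with basis $(R_\nu)_{\nu\in\mathbb{N}^s_n}$, and let $\phi=\bigoplus_{i=1}^t\phi_i:\mathcal{B}\to\bigoplus_{i=1}^t\mathbb{C}^{p_i\times p_i}$ be a given block diagonalization (an isomorphism of $\ast$-algebras). Let $$\psi:\mathcal{A}\to\bigoplus_{\mu\in\mathbb{N}^t_n}\bigotimes_{i=1}^t\mathrm{Sym}^{\mu_i}(\mathbb{C}^{p_i\times p_i})$$ be the isomorphism induced by $\phi$ as defined in the context. Then for all complex numbers $y_\nu$ ($\nu\in\mathbb{N}^s_n$), $$\psi\Bigl(\sum_{\nu\in\mathbb{N}^s_n}y_\nu R_\nu\Bigr)=\bigoplus_{\mu\in\mathbb{N}^t_n}\ \sum_{D=(D_1,\ldots,D_t)}y_D\bigotimes_{i=1}^tA_{D_i},$$ where in the $\mu$-summand the sum runs over all tuples $D=(D_1,\ldots,D_t)$ with $D_i\in\mathbb{N}^{p_i\times p_i}$ and $\mathbf{1}^{\mathsf T}D_i\mathbf{1}=\mu_i$ for $i=1,\ldots,t$, and the coefficients are $$y_D=\sum_{\nu\in\mathbb{N}^s_n}y_\nu\left(\prod_{j=1}^t\prod_{k,l=1}^{p_j}\Bigl(\sum_{i=1}^sx_i\,(\phi_j(R_i))_{k,l}\Bigr)^{(D_j)_{k,l}}\right)[x^\nu].$$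
   Context: $\mathbb{N}=\{0,1,2,\ldots\}$; $\mathbb{N}^k_n$ is the set of $\nu\in\mathbb{N}^k$ with $\nu_1+\cdots+\nu_k=n$; $\mathbf 1$ is the all-ones vector. For a polynomial $f$ in indeterminates $x_1,\ldots,x_s$, $f[x^\nu]$ denotes the coefficient of the monomial $x_1^{\nu_1}\cdots x_s^{\nu_s}$ in $f$. A matrix $\ast$-algebra is a set of square complex matrices closed under addition, scalar multiplication, matrix multiplication and conjugate transpose. For a vector space $V$, $\mathrm{Sym}^n(V)\subseteq V^{\otimes n}$ is the subspace of tensors invariant under permuting the $n$ tensor factors. The weight of a word $x\in S^n$ over a finite set $S$ is $w(x)\in\mathbb{N}^S$ with $w(x)_u$ the number of occurrences of $u$ in $x$. If $(v_u)_{u\in S}$ is a basis of $V$, then $\mathrm{Sym}^n(V)$ has basis $v_\nu:=\sum_{x\in S^n,\,w(x)=\nu}v_{x_1}\otimes\cdots\otimes v_{x_n}$, for $\nu\in\mathbb{N}^S$ with total $n$. In particular $R_\nu:=\sum_{x\in\{1,\ldots,s\}^n,\,w(x)=\nu}R_{x_1}\otimes\cdots\otimes R_{x_n}$. For $m\geq 0$ and $D\in\mathbb{N}^{p\times p}$ with entries summing to $m$, $A_D\in\mathrm{Sym}^m(\mathbb{C}^{p\times p})$ denotes the basis element obtained in this way from the standard basis of matrix units $E_{(k,l)}$ of $\mathbb{C}^{p\times p}$, i.e. $A_D=\sum_{x\in([p]\times[p])^m,\,w(x)=D}E_{x_1}\otimes\cdots\otimes E_{x_m}$ (for $m=0$,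 $\mathrm{Sym}^0=\mathbb{C}$ and $A_0=1$). Definition of $\psi$: the standard basis $E_{(i,k,l)}$ ($1\le i\le t$, $1\le k,l\le p_i$) of $\bigoplus_{i=1}^t\mathbb{C}^{p_i\times p_i}$ yields the basis $(E_D)$ of $\mathrm{Sym}^n(\bigoplus_{i=1}^t\mathbb{C}^{p_i\times p_i})$ consisting of $E_D:=\sum_{w(x)=D}E_{x_1}\otimes\cdots\otimes E_{x_n}$, indexed by $D=(D_1,\ldots,D_t)$, $D_i\in\mathbb{N}^{p_i\times p_i}$, with total entry sum $n$ (the sum being over words $x$ of length $n$ in the index triples $(i,k,l)$ in which $(i,k,l)$ occurs exactly $(D_i)_{k,l}$ times). The map $\psi$ is the composition of the restriction of $\phi^{\otimes n}$ to $\mathcal{A}$, which maps $\mathcal{A}$ onto $\mathrm{Sym}^n(\bigoplus_{i}\mathbb{C}^{p_i\times p_i})$, with the isomorphism $\mathrm{Sym}^n(\bigoplus_i\mathbb{C}^{p_i\times p_i})\to\bigoplus_{\mu\in\mathbb{N}^t_n}\bigotimes_{i=1}^t\mathrm{Sym}^{\mu_i}(\mathbb{C}^{p_i\times p_i})$ that is the linear map sending $E_D$ to the element $A_{D_1}\otimes\cdots\otimes A_{D_t}$ of the summand with index $\mu=(\mathbf 1^{\mathsf T}D_1\mathbf 1,\ldots,\mathbf 1^{\mathsf T}D_t\mathbf 1)$ and all other components equal to $0$. *)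

(* Defs.v *)
From HB Require Import structures.
From mathcomp Require Import all_boot all_order all_fingroup all_algebra.
From mathcomp Require Import reals complex mpoly.

Set Implicit Arguments.
Unset Strict Implicit.
Unset Printing Implicit Defensive.

Import Order.TTheory GRing.Theory Num.Theory.
Local Open Scope ring_scope.

(* The set of d : S -> nat with total m (the entries are then at most m). *)
Record multi (S : finType) (m : nat) := Multi {
  multi_val : {ffun S -> 'I_m.+1};
  _ : (\sum_(u : S) multi_val u == m)%N }.

HB.instance Definition _ (S : finType) (m : nat) :=
  [isSub for @multi_val S m].
HB.instance Definition _ (S : finType) (m : nat) :=
  [Finite of multi S m by <:].

Definition multi_fun (S : finType) (m : nat) (d : multi S m) : S -> nat :=
  fun u => multi_val d u.
Coercion multi_fun : multi >-> Funclass.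

Definition has_weight (S : finType) (m : nat) (d : S -> nat)
    (x : m.-tuple S) : bool :=
  [forall u, count_mem u x == d u].

Record dsum (K : fieldType) (I : finType) (V : I -> vectType K) := DSum {
  dsum_val : {dffun forall i : I, V i} }.

Section DirectSum.
Variables (K : fieldType) (I : finType) (V : I -> vectType K).

HB.instance Definition _ := [isNew for @dsum_val K I V].
HB.instance Definition _ := [Choice of dsum V by <:].

Definition mk_dsum (f : forall i, V i) : dsum V := DSum (finfun f).

Definition dsum_fun (f : dsum V) : forall i, V i := fun i => dsum_val f i.
Coercion dsum_fun : dsum >-> Funclass.

Lemma mk_dsumE f i : mk_dsum f i = f i.
Proof. exact: ffunE. Qed.

Lemma dsumP (f g : dsum V) : (forall i, f i = g i) <-> f = g.
Proof.
split=> [fg|-> //]; apply: val_inj; apply/ffunP=> i; exact: fg.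
Qed.

Let zero := mk_dsum (fun=> 0).
Let add (f g : dsum V) := mk_dsum (fun i => f i + g i).
Let opp (f : dsum V) := mk_dsum (fun i => - f i).
Let scale (a : K) (f : dsum V) := mk_dsum (fun i => a *: f i).

Fact dsum_addA : associative add.
Proof. by move=> f g h; apply/dsumP=> i; rewrite !mk_dsumE addrA. Qed.
Fact dsum_addC : commutative add.
Proof. by move=> f g; apply/dsumP=> i; rewrite !mk_dsumE addrC. Qed.
Fact dsum_add0 : left_id zero add.
Proof. by move=> f; apply/dsumP=> i; rewrite !mk_dsumE add0r. Qed.
Fact dsum_addN : left_inverse zero opp add.
Proof. by move=> f; apply/dsumP=> i; rewrite !mk_dsumE addNr. Qed.

HB.instance Definition _ := GRing.isZmodule.Build (dsum V)
  dsum_addA dsum_addC dsum_add0 dsum_addN.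

Fact dsum_scaleA a b f : scale a (scale b f) = scale (a * b) f.
Proof. by apply/dsumP=> i; rewrite !mk_dsumE scalerA. Qed.
Fact dsum_scale1 : left_id 1 scale.
Proof. by move=> f; apply/dsumP=> i; rewrite !mk_dsumE scale1r. Qed.
Fact dsum_scaleDr : right_distributive scale +%R.
Proof. by move=> a f g; apply/dsumP=> i; rewrite !mk_dsumE scalerDr. Qed.
Fact dsum_scaleDl f : {morph scale^~ f : a b / a + b}.
Proof. by move=> a b; apply/dsumP=> i; rewrite !mk_dsumE scalerDl. Qed.

HB.instance Definition _ := GRing.Zmodule_isLmodule.Build K (dsum V)
  dsum_scaleA dsum_scale1 dsum_scaleDr dsum_scaleDl.

Lemma dsum0E i : (0 : dsum V) i = 0.
Proof. exact: mk_dsumE. Qed.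
Lemma dsumDE (f g : dsum V) i : (f + g) i = f i + g i.
Proof. exact: mk_dsumE. Qed.
Lemma dsumZE a (f : dsum V) i : (a *: f) i = a *: f i.
Proof. exact: mk_dsumE. Qed.
Lemma dsum_sumE (J : Type) (r : seq J) (P : pred J) (F : J -> dsum V) i :
  (\sum_(j <- r | P j) F j) i = \sum_(j <- r | P j) F j i.
Proof.
apply: (big_morph (fun f : dsum V => f i)) => [f g|]; first exact: dsumDE.
exact: dsum0E.
Qed.

Import VectorInternalTheory.
Fact dsum_vect_iso :
  Vector.axiom (dim {ffun {i : I & 'I_(dim (V i))} -> K^o}) (dsum V).
Proof.
pose fr (f : dsum V) : {ffun {i : I & 'I_(dim (V i))} -> K^o} :=
  [ffun u => v2r (f (tag u)) 0 (tagged u)].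
have frE f u : fr f u = v2r (f (tag u)) 0 (tagged u) by rewrite ffunE.
exists (fun f => v2r (fr f)).
  move=> a f g; rewrite -linearP; congr v2r; apply/ffunP=> u.
  rewrite frE dsumDE dsumZE linearP mxE [X in X + _]mxE -!frE.
  by rewrite [RHS]ffunE [in RHS]ffunE.
pose gr (w : {ffun {i : I & 'I_(dim (V i))} -> K^o}) : dsum V :=
  mk_dsum (fun i => r2v (\row_k w (Tagged _ k))).
exists (fun r => gr (r2v r)) => [f|r].
  rewrite v2rK; apply/dsumP=> i; rewrite mk_dsumE; apply: (canLR v2rK).
  by apply/rowP=> k; rewrite mxE frE.
apply: (canLR r2vK); apply/ffunP=> -[i k].
by rewrite frE mk_dsumE r2vK mxE.
Qed.

HB.instance Definition _ := Lmodule_hasFinDim.Build K (dsum V) dsum_vect_iso.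

Definition dsum_in (i : I) (v : V i) : dsum V :=
  mk_dsum (dfwith (fun j => 0 : V j) v).

End DirectSum.

(* The tensor product of the V i is modelled by the coordinates on the basis
   of products of elements of the library's bases vbasis of the V i. *)
Definition widx (K : fieldType) (I : finType) (V : I -> vectType K) : finType :=
  {dffun forall i : I, 'I_(\dim {: V i})}.

Definition tens (K : fieldType) (I : finType) (V : I -> vectType K) :=
  {ffun widx V -> K^o}.

HB.instance Definition _ (K : fieldType) (I : finType) (V : I -> vectType K) :=
  Vector.copy (tens V) {ffun widx V -> K^o}.

Section Tensor.
Variables (K : fieldType) (I : finType).

Definition pure (V : I -> vectType K) (v : forall i, V i) : tens V :=
  [ffun x : widx V => \prod_i coord (vbasis {: V i}) (x i) (v i)].

Lemma pureE (V : I -> vectType K) (v : forall i, V i) (x : widx V) :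
  pure v x = \prod_i coord (vbasis {: V i}) (x i) (v i) :> K.
Proof. exact: ffunE. Qed.

Lemma eq_pure (V : I -> vectType K) (v w : forall i, V i) :
  (forall i, v i = w i) -> pure v = pure w.
Proof.
by move=> vw; apply/ffunP=> x; rewrite !pureE; apply: eq_bigr => i _; rewrite vw.
Qed.

Definition tbas (V : I -> vectType K) (x : widx V) : forall i, V i :=
  fun i => (vbasis {: V i})`_(x i).

(* The basis tensor of index x is sent to g x. *)
Definition tlift_def (V : I -> vectType K) (U : vectType K) (g : widx V -> U)
    (T : tens V) : U :=
  \sum_(x : widx V) (T x : K) *: g x.

Fact tlift_is_linear (V : I -> vectType K) (U : vectType K) (g : widx V -> U) : linear (tlift_def g).
Proof.
move=> a S T; rewrite /tlift_def scaler_sumr -big_split.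
by apply: eq_bigr => x _; rewrite !ffunE scalerDl scalerA.
Qed.
HB.instance Definition _ (V : I -> vectType K) (U : vectType K) (g : widx V -> U) :=
  GRing.isLinear.Build K (tens V) U _ (tlift_def g) (tlift_is_linear g).

Definition tlift (V : I -> vectType K) (U : vectType K) (g : widx V -> U) : 'Hom(tens V, U) :=
  linfun (tlift_def g).

Lemma tliftE (V : I -> vectType K) (U : vectType K) (g : widx V -> U)
    (T : tens V) :
  tlift g T = \sum_(x : widx V) (T x : K) *: g x.
Proof. exact: lfunE. Qed.

Definition tmap (V W : I -> vectType K) (f : forall i, 'Hom(V i, W i)) :
    'Hom(tens V, tens W) :=
  tlift (fun x => pure (fun i => f i (tbas x i))).

Lemma bigA_distr_dffun (T : I -> finType) (F : forall i, T i -> K) :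
  \prod_i \sum_(a : T i) F i a =
  \sum_(x : {dffun forall i, T i}) \prod_i F i (x i).
Proof.
pose P i : {ffun T i -> K} := [ffun a => F i a].
transitivity (\sum_(x : fprod T) \prod_(i in I) P i (x i)).
  rewrite (@big_fprod K 0 1 *%R +%R I T P).
  rewrite -(bigA_distr_big_dep (fun i j => j \in tagged_with T i)
             (fun i => untag 0 (P i))).
  apply: eq_bigr => i _; rewrite -(big_tag (fun i => P i) i).
  by apply: eq_bigr => a _; rewrite ffunE.
rewrite (reindex (@fprod_of_dffun _ T)) /=; last first.
  exact/onW_bij/fprod_of_dffun_bij.
by apply: eq_bigr => x _; apply: eq_bigr => i _; rewrite ffunE fprodE.
Qed.

Lemma sum_pure (V : I -> vectType K) (f : forall i, {linear V i -> K^o})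
    (v : forall i, V i) :
  \sum_(x : widx V) (pure v x : K) * \prod_i (f i (tbas x i) : K) =
  \prod_i (f i (v i) : K).
Proof.
under [LHS]eq_bigr => x _ do rewrite pureE -big_split /=.
rewrite -(bigA_distr_dffun
  (fun i a => coord (vbasis {: V i}) a (v i) * f i (vbasis {: V i})`_a)).
apply: eq_bigr => i _; rewrite [in RHS](coord_vbasis (memvf (v i))).
by rewrite linear_sum; apply: eq_bigr => a _; rewrite linearZ.
Qed.

Lemma tmap_pure (V W : I -> vectType K) (f : forall i, 'Hom(V i, W i)) (v : forall i, V i) :
  tmap f (pure v) = pure (fun i => f i (v i)).
Proof.
rewrite tliftE; apply/ffunP=> y; rewrite sum_ffunE [RHS]pureE.
pose c i : {linear V i -> K^o} :=
  coord (vbasis {: W i}) (y i) \o f i.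
rewrite -(sum_pure c v).
by apply: eq_bigr => x _; rewrite ffunE; congr (_ * _); exact: pureE.
Qed.

End Tensor.

Definition tpow (K : fieldType) (V : vectType K) (n : nat) :=
  tens (fun _ : 'I_n => V).

Section SymmetricPower.
Variables (K : fieldType) (V : vectType K) (n : nat).

HB.instance Definition _ := Vector.copy (tpow V n) (tens (fun _ : 'I_n => V)).

(* Permuting the tensor factors: v_1 (x) ... (x) v_n is sent to
   v_(s 1) (x) ... (x) v_(s n), see tswap_pure. *)
Definition tswap (s : 'S_n) : 'End(tpow V n) :=
  tlift (fun x => pure (fun j => tbas x (s j))).

Lemma tswap_pure (s : 'S_n) (v : 'I_n -> V) :
  tswap s (pure v) = pure (fun j => v (s j)).
Proof.
rewrite tliftE; apply/ffunP=> y; rewrite sum_ffunE [RHS]pureE.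
rewrite [RHS](reindex_inj (@perm_inj _ s^-1)) /=.
under [RHS]eq_bigr do rewrite permKV.
pose c i : {linear V -> K^o} := coord (vbasis {: V}) (y ((s^-1)%g i)).
rewrite -(sum_pure c v); apply: eq_bigr => x _; rewrite ffunE.
congr (_ * _); rewrite pureE (reindex_inj (@perm_inj _ s^-1)) /=.
by apply: eq_bigr => i _; rewrite permKV.
Qed.

Definition Sym : {vspace tpow V n} :=
  (\bigcap_(s : 'S_n) fixedSpace (tswap s))%VS.

Definition sym_tensor (S : finType) (v : S -> V) (d : S -> nat) : tpow V n :=
  \sum_(x : n.-tuple S | has_weight d x) pure (fun j => v (tnth x j)).

Fact sym_tensor_in S v d : @sym_tensor S v d \in Sym.
Proof.
rewrite memvE; apply/subv_bigcapP => s _; rewrite -memvE.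
apply/fixedSpaceP; rewrite linear_sum /=.
under eq_bigr do rewrite tswap_pure.
pose perm_word (x : n.-tuple S) := [tuple tnth x (s j) | j < n].
have perm_word_inj : injective perm_word.
  move=> x y /(congr1 (fun z => tnth z _)) xy; apply: eq_from_tnth => j.
  by have := xy (s^-1 j)%g; rewrite !tnth_mktuple permKV.
rewrite [RHS](reindex_inj perm_word_inj) /=; apply: eq_big => [x|x _].
  apply: eq_forallb => u; congr (_ == _); apply/esym/seq.permP.
  by apply/tuple_permP; exists s.
by apply: eq_pure => j; rewrite tnth_mktuple.
Qed.

Definition sym_basis (S : finType) (v : S -> V) (d : S -> nat) :
    subvs_of Sym :=
  Subvs (sym_tensor_in v d).

End SymmetricPower.

Section SymmetricPowerMap.
Variables (K : fieldType) (V W : vectType K) (n : nat) (f : 'Hom(V, W)).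

Definition tpow_map : 'Hom(tpow V n, tpow W n) := tmap (fun _ : 'I_n => f).

Fact tpow_map_in T : T \in Sym V n -> tpow_map T \in Sym W n.
Proof.
rewrite !memvE => /subv_bigcapP TS; apply/subv_bigcapP => s _.
have {TS} /fixedSpaceP Ts : T \in fixedSpace (tswap V s).
  by rewrite memvE TS.
rewrite -memvE; apply/fixedSpaceP; rewrite -[in RHS]Ts.
rewrite [tpow_map T]tliftE [tswap V s T]tliftE !linear_sum.
by apply: eq_bigr => x _; rewrite !linearZ /= tswap_pure tmap_pure.
Qed.

Definition Sym_map (T : subvs_of (Sym V n)) : subvs_of (Sym W n) :=
  Subvs (tpow_map_in (subvsP T)).

End SymmetricPowerMap.

Section LinearExtension.
Variables (K : fieldType) (I : finType) (aT : vectType K) (rT : lmodType K).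

(* Sends b i to g i when the b i are linearly independent; its values outside
   the span of the b i are arbitrary. *)
Definition lin_ext (b : I -> aT) (g : I -> rT) : {linear aT -> rT} :=
  sval (linear_of_free (codom b) (codom g)).

Lemma lin_extE b g i : free (codom b) -> lin_ext b g (b i) = g i.
Proof.
rewrite /lin_ext; case: linear_of_free => h /= hb fb.
have {hb}:= hb fb; rewrite !size_codom => /(_ erefl).
rewrite /codom /image_mem -map_comp.
by move/eq_in_map/(_ i (mem_enum _ i)).
Qed.

Lemma free_codom (b : I -> aT) :
  (forall c : I -> K, \sum_i c i *: b i = 0 -> forall i, c i = 0) ->
  free (codom b).
Proof.
move=> hb; have := @freeP _ _ _ (codom_tuple b); rewrite /= => fP; apply/fP.
move=> c c0 i; rewrite -(enum_valK i).
apply: (hb (c \o enum_rank)); rewrite -[RHS]c0.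
rewrite [LHS](reindex (fun j : 'I_#|I| => enum_val j)) /=; last first.
  exact/onW_bij/enum_val_bij.
apply: eq_bigr => j _; rewrite enum_valK; congr (_ *: _).
by rewrite nth_codom.
Qed.

End LinearExtension.

Section FreeSym.
Variables (K : fieldType) (V : vectType K) (n : nat) (S : finType).

Fact multi_word (d : multi S n) : exists x : n.-tuple S, has_weight d x.
Proof.
pose w := flatten [seq nseq (d u) u | u <- enum S].
have sw : size w == n.
  rewrite size_flatten /shape -map_comp sumnE big_map big_enum /=.
  under eq_bigr do rewrite size_nseq.
  exact: (valP d).
exists (Tuple sw); apply/forallP => u /=; rewrite count_flatten -map_comp.
rewrite sumnE big_map big_enum /= (bigD1 u) //= count_nseq /= eqxx mul1n.
by rewrite big1 ?addn0 // => v vu; rewrite count_nseq /= (negPf vu).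
Qed.

(* The v_d form a linearly independent family as soon as v has a dual family
   of linear forms. *)
Lemma free_sym_basis (v : S -> V) (f : S -> {linear V -> K^o}) :
  (forall u w, f u (v w) = (w == u)%:R) ->
  free (codom (fun d : multi S n => sym_basis n v d)).
Proof.
move=> fv; apply: free_codom => c c0 d.
have [x0 dx0] := multi_word d.
pose ev (T : tpow V n) : K :=
  \sum_(x : widx (fun _ : 'I_n => V))
    (T x : K) * \prod_j (f (tnth x0 j) (tbas x j) : K).
have evP : linear (ev : tpow V n -> K^o).
  move=> a T U; rewrite /ev scaler_sumr -big_split; apply: eq_bigr => x _.
  by rewrite !ffunE mulrDl; congr (_ + _); exact/esym/mulrA.
pose evM := GRing.isLinear.Build K (tpow V n) K^o _ ev evP.
pose evL : {linear tpow V n -> K^o} := HB.pack ev evM.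
have ev_pure (x : n.-tuple S) :
    evL (pure (fun j => v (tnth x j))) = (x == x0)%:R.
  rewrite [LHS](sum_pure (fun j => f (tnth x0 j))).
  under eq_bigr do rewrite fv.
  case: eqP => [->|xx0]; first by rewrite big1 // => j _; rewrite eqxx.
  have [j xj] : exists j, tnth x j != tnth x0 j.
    apply/existsP; rewrite -negb_forall; apply/negP => /forallP e.
    by apply: xx0; apply: eq_from_tnth => j; apply/eqP.
  by rewrite (bigD1 j) //= (negPf xj) mul0r.
have ev_sym (d' : multi S n) :
    evL (vsval (sym_basis n v d')) = (has_weight d' x0)%:R.
  rewrite linear_sum; under eq_bigr do rewrite ev_pure.
  case: (boolP (has_weight d' x0)) => h.
    by rewrite (bigD1 x0) //= eqxx big1 ?addr0 // => x /andP[_ /negPf ->].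
  by rewrite big1 // => x hx; case: eqP hx h => // -> ->.
have ev_c (d' : multi S n) :
    evL (vsval (c d' *: sym_basis n v d')) = c d' * (has_weight d' x0)%:R.
  by rewrite !linearZ ev_sym.
have := congr1 (fun T => evL (vsval T)) c0; rewrite !linear0 !linear_sum.
under eq_bigr do rewrite ev_c.
rewrite (bigD1 d) // big1 => [|d' dd'] /=; first by rewrite dx0 mulr1 addr0.
case: (boolP (has_weight d' x0)) => [h|_]; last by rewrite mulr0.
case/eqP: dd'; apply: val_inj; apply/ffunP => u; apply: val_inj.
move/forallP/(_ u)/eqP: h; move/forallP/(_ u)/eqP: dx0 => -> e.
exact/esym/e.
Qed.

End FreeSym.

Definition adjmx (R : realType) (N : nat) (X : 'M[R[i]]_N) : 'M[R[i]]_N :=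
  map_mx Num.conj X^T.

Definition matrix_star_algebra (R : realType) (N : nat)
    (B : {vspace 'M[R[i]]_N}) : Prop :=
  (forall X Y, X \in B -> Y \in B -> X *m Y \in B) /\
  (forall X, X \in B -> adjmx X \in B).

Definition blocks (R : realType) (t : nat) (p : 'I_t -> nat) :=
  dsum (fun i : 'I_t => 'M[R[i]]_(p i)).

Definition block_diagonalization (R : realType) (N t : nat) (p : 'I_t -> nat)
    (B : {vspace 'M[R[i]]_N}) (phi : 'Hom(subvs_of B, blocks R p)) : Prop :=
  [/\ bijective phi,
      forall X Y Z : subvs_of B, vsval Z = vsval X *m vsval Y ->
        forall i, phi Z i = phi X i *m phi Y i
    & forall X Z : subvs_of B, vsval Z = adjmx (vsval X) ->
        forall i, phi Z i = adjmx (phi X i)].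

Section Psi.
Variables (R : realType) (t : nat) (p : 'I_t -> nat) (n : nat).

Definition triple : finType := {i : 'I_t & ('I_(p i) * 'I_(p i))%type}.

Definition mk_triple (i : 'I_t) (k l : 'I_(p i)) : triple :=
  Tagged (fun i => ('I_(p i) * 'I_(p i))%type) (k, l).

Definition std_blocks (u : triple) : blocks R p :=
  dsum_in (delta_mx (tagged u).1 (tagged u).2 : 'M[R[i]]_(p (tag u))).

(* A tuple D = (D_1, ..., D_t) of matrices is encoded as one function on the
   index triples (i, k, l), with block D i the matrix D_i. *)
Definition block (D : triple -> nat) (i : 'I_t) : 'I_(p i) * 'I_(p i) -> nat :=
  fun kl => D (mk_triple kl.1 kl.2).

Definition block_total (D : triple -> nat) (i : 'I_t) : nat :=
  \sum_(k < p i) \sum_(l < p i) block D (k, l).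

Definition has_block_totals (D : triple -> nat) (mu : 'I_t -> nat) : bool :=
  [forall i, block_total D i == mu i].

Definition E_blocks (D : triple -> nat) : subvs_of (Sym (blocks R p) n) :=
  sym_basis n std_blocks D.

(* A_D; it is 0 unless the entries of D sum to m. *)
Definition A_sym (q m : nat) (D : 'I_q * 'I_q -> nat) :
    subvs_of (Sym 'M[R[i]]_q m) :=
  sym_basis m (fun kl => delta_mx kl.1 kl.2) D.

Definition summand (mu : 'I_t -> nat) :=
  tens (fun i : 'I_t => subvs_of (Sym 'M[R[i]]_(p i) (mu i))).

(* A_(D_1) (x) ... (x) A_(D_t), where D_i has total mu_i. *)
Definition A_tensor (mu : 'I_t -> nat) (D : triple -> nat) : summand mu :=
  pure (fun i => A_sym (mu i) (block D (i := i))).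

Definition psi_codomain := dsum (fun mu : multi 'I_t n => summand mu).

(* lin_ext is the intended map here because the E_D are linearly independent
   (free_E_blocks); they span Sym^n. *)
Definition split_blocks :
    {linear subvs_of (Sym (blocks R p) n) -> psi_codomain} :=
  lin_ext (fun D : multi triple n => E_blocks D)
    (fun D => mk_dsum (fun mu : multi 'I_t n =>
       if has_block_totals D mu then A_tensor mu D else 0)).

Definition psi (N : nat) (B : {vspace 'M[R[i]]_N})
    (phi : 'Hom(subvs_of B, blocks R p)) (T : subvs_of (Sym (subvs_of B) n)) :
    psi_codomain :=
  split_blocks (Sym_map phi T).

Let entry (u : triple) (b : blocks R p) : (R[i])^o :=
  b (tag u) (tagged u).1 (tagged u).2.

Fact entry_is_linear u : linear (entry u).
Proof. by move=> a b c; rewrite /entry dsumDE dsumZE !mxE. Qed.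
HB.instance Definition _ u := GRing.isLinear.Build _ _ _ _ (entry u)
  (entry_is_linear u).

Lemma free_E_blocks : free (codom (fun D : multi triple n => E_blocks D)).
Proof.
apply: (@free_sym_basis _ _ _ _ _ (fun u => entry u)) => u w /=.
rewrite /entry /std_blocks mk_dsumE.
case: u w => [i kl] [j [k' l']] /=; move: kl.
case: dfwithP => [|{}i ji] [k l]; rewrite mxE -tag_eqE /tag_eq /=.
  by rewrite eqxx tagged_asE xpair_eqE ![k' == _]eq_sym ![l' == _]eq_sym.
by rewrite (negPf ji).
Qed.

End Psi.

(* Main.v *)
Require Import Defs.
From HB Require Import structures.
From mathcomp Require Import all_boot all_order all_fingroup all_algebra.
From mathcomp Require Import reals complex mpoly.

(** Write phi(R_i) = sum_u a_(i,u) E_u, where u runs over the index triples and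
    a_(i,u) is an entry of phi(R_i).  The n-th tensor power of phi sends
    R_x1 (x) ... (x) R_xn to the product of these sums, which expands
    ([pure_sum]) as the sum over the words z of length n in triples of
    prod_j a_(x_j,z_j) times E_z1 (x) ... (x) E_zn.  Summing over the words x
    of weight nu, the coefficient of E_z1 (x) ... (x) E_zn in the image of
    R_nu is the sum over x of weight nu of prod_j a_(x_j,z_j); that is what one
    gets by expanding the product of linear forms
    prod_j (sum_i a_(i,z_j) X_i) and reading off the coefficient of X^nu
    ([mcoeff_prod_linear_forms]).

    This product of linear forms depends on z only through its weight D: it is
    prod_u (sum_i a_(i,u) X_i)^(D_u) ([prod_word]).  Grouping the words z by
    weight therefore writes the image of R_nu as a combination of the E_D whose
    coefficients are the asserted ones ([Sym_map_basis]).  Applying the map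
    E_D |-> A_D1 (x) ... (x) A_Dt gives the theorem for R_nu, and both sides are
    linear in y. *)

Set Implicit Arguments.
Unset Strict Implicit.
Unset Printing Implicit Defensive.

Import Order.TTheory GRing.Theory Num.Theory.
Local Open Scope ring_scope.

(** * Words and their weights *)

Section Words.
Variables (T : finType) (n : nat).

Fact word_weight_subproof (z : n.-tuple T) :
  (\sum_u [ffun u => inord (count_mem u z) : 'I_n.+1] u == n)%N.
Proof.
have leqn u : (count_mem u z < n.+1)%N.
  by rewrite ltnS (leq_trans (count_size _ _)) ?size_tuple.
under eq_bigr do rewrite ffunE inordK //.
apply/eqP; rewrite -[RHS](size_tuple z) -sum1_size [RHS](partition_big id predT) //=.
by apply: eq_bigr => u _; rewrite sum1_count.
Qed.

Definition word_weight (z : n.-tuple T) : multi T n :=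
  Multi (word_weight_subproof z).

Lemma word_weightE z u : word_weight z u = count_mem u z.
Proof.
by rewrite /multi_fun ffunE inordK // ltnS (leq_trans (count_size _ _))
  ?size_tuple.
Qed.

Lemma has_weightE (D : multi T n) z : has_weight D z = (word_weight z == D).
Proof.
apply/forallP/eqP => [zD|<- u]; last by rewrite word_weightE.
apply/val_inj/ffunP => u; apply/val_inj.
by have := zD u; rewrite -word_weightE => /eqP.
Qed.

Lemma sum_words_by_weight (V : nmodType) (F : n.-tuple T -> V) :
  \sum_z F z = \sum_(D : multi T n) \sum_(z | has_weight D z) F z.
Proof.
rewrite (partition_big word_weight predT) //=; apply: eq_bigr => D _.
by apply: eq_bigl => z; rewrite has_weightE.
Qed.

(** The factors of the product commute, so it only sees how often each letter
    occurs in the word. *)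
Lemma prod_word (A : comPzSemiRingType) (d : T -> nat) (g : T -> A)
    (z : n.-tuple T) :
  has_weight d z -> \prod_(j < n) g (tnth z j) = \prod_u g u ^+ d u.
Proof.
move=> /forallP zd; rewrite -(big_tuple _ _ z xpredT g).
rewrite [LHS](partition_big id predT) //=; apply: eq_bigr => u _.
rewrite -(eqP (zd u)) (eq_bigr (fun=> g u)) => [|v /eqP-> //].
by rewrite big_const_seq -Monoid.iteropE.
Qed.

(** Distributivity; words, rather than finite functions, index the terms
    because the basis of a symmetric power is defined by sums over words. *)
Lemma prod_sum_words (A : comPzSemiRingType) (F : 'I_n -> T -> A) :
  \prod_j \sum_u F j u = \sum_(z : n.-tuple T) \prod_j F j (tnth z j).
Proof.
rewrite bigA_distr_bigA (reindex (fun z : n.-tuple T => [ffun j => tnth z j])).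
  by apply: eq_bigr => z _; apply: eq_bigr => j _; rewrite ffunE.
apply: onW_bij; exists (fun f : {ffun 'I_n -> T} => [tuple f j | j < n]) => [z|f].
  by apply: eq_from_tnth => j; rewrite tnth_mktuple ffunE.
by apply/ffunP => j; rewrite ffunE tnth_mktuple.
Qed.

End Words.

(** * Coefficients of products of linear forms *)

(** Expanding the product picks one variable from each factor, that is, a word
    x; the monomial it contributes is X^nu exactly when x has weight nu. *)
Lemma mcoeff_prod_linear_forms (K : comNzRingType) (s n : nat)
    (nu : 'I_s -> nat) (c : 'I_n -> 'I_s -> K) :
  (\prod_(j < n) \sum_(i < s) c j i *: 'X_i : {mpoly K[s]})
    @_[multinom nu i | i < s] =
  \sum_(x : n.-tuple 'I_s | has_weight nu x) \prod_j c j (tnth x j).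
Proof.
rewrite prod_sum_words linear_sum [RHS]big_mkcond; apply: eq_bigr => x _ /=.
rewrite scaler_prod mcoeffZ mprodXE mcoeffX.
suff -> : (\sum_(j < n) U_(tnth x j) == [multinom nu i | i < s])%MM =
          has_weight nu x by case: ifP => _; rewrite ?mulr1 ?mulr0.
have cnt u : (\sum_(j < n) U_(tnth x j))%MM u = count_mem u x.
  rewrite mnm_sumE -(big_tuple _ _ x xpredT (fun v => U_(v)%MM u)) /=.
  rewrite -sum1_count [RHS]big_mkcond.
  by apply: eq_bigr => v _; rewrite mnm1E /=; case: (v == u).
apply/eqP/forallP => [e u|xnu].
  by rewrite -cnt e mnmE.
by apply/mnmP => u; rewrite cnt mnmE; apply/eqP.
Qed.

(** * The symmetric power of a linear map, in coordinates *)

Section SymmetricPowerOfMap.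
Variables (K : fieldType) (V W : vectType K) (n : nat).

(** Multilinearity of the elementary tensors in all n arguments at once. *)
Lemma pure_sum (T : finType) (w : T -> W) (c : 'I_n -> T -> K) :
  pure (fun j => \sum_u c j u *: w u) =
  \sum_(z : n.-tuple T)
     (\prod_j c j (tnth z j)) *: pure (fun j => w (tnth z j)).
Proof.
apply/ffunP => b; rewrite pureE sum_ffunE.
under eq_bigr do rewrite linear_sum.
rewrite prod_sum_words; apply: eq_bigr => z _.
rewrite ffunE pureE /GRing.scale /= -big_split.
by apply: eq_bigr => j _; rewrite linearZ.
Qed.

Fact Sym_map_is_linear (f : 'Hom(V, W)) : linear (@Sym_map K V W n f).
Proof. by move=> a x y; apply/val_inj; rewrite /= !linearP. Qed.

HB.instance Definition _ (f : 'Hom(V, W)) :=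
  GRing.isLinear.Build K _ _ _ (@Sym_map K V W n f) (Sym_map_is_linear f).

(** The matrix of the n-th symmetric power of f, when the v_i are sent to
    combinations of the w_u.  The coefficient of a tensor w_z1 (x) ... (x) w_zn
    depends only on the weight of z, so the sum over words regroups into the
    symmetric tensors of the w_u. *)
Lemma Sym_map_basis (s : nat) (T : finType) (f : 'Hom(V, W))
    (v : 'I_s -> V) (w : T -> W) (a : 'I_s -> T -> K) (nu : 'I_s -> nat) :
  (forall i, f (v i) = \sum_u a i u *: w u) ->
  Sym_map f (sym_basis n v nu) =
  \sum_(D : multi T n)
    (\prod_u (\sum_(i < s) a i u *: 'X_i : {mpoly K[s]}) ^+ D u)
       @_[multinom nu i | i < s] *: sym_basis n w D.
Proof.
move=> fv; apply/val_inj; rewrite /= linear_sum [RHS]linear_sum /=.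
(* The image as a combination of elementary tensors, before grouping. *)
transitivity (\sum_(z : n.-tuple T)
    (\sum_(x : n.-tuple 'I_s | has_weight nu x)
        \prod_j a (tnth x j) (tnth z j)) *: pure (fun j => w (tnth z j))).
  under [RHS]eq_bigr do rewrite scaler_suml.
  rewrite [RHS]exchange_big; apply: eq_bigr => x _ /=.
  by rewrite tmap_pure (eq_pure (fun j => fv (tnth x j))) pure_sum.
rewrite sum_words_by_weight; apply: eq_bigr => D _.
rewrite scaler_sumr; apply: eq_bigr => z zD; congr (_ *: _).
by rewrite -(prod_word _ zD) mcoeff_prod_linear_forms.
Qed.

End SymmetricPowerOfMap.

(** * Direct sums of matrix blocks *)

Section Blocks.
Variables (R : realType) (t : nat) (p : 'I_t -> nat) (n : nat).

Lemma big_triples (A : Type) (idx : A) (op : Monoid.com_law idx)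
    (F : triple p -> A) :
  \big[op/idx]_u F u =
  \big[op/idx]_(j < t) \big[op/idx]_(k < p j) \big[op/idx]_(l < p j)
    F (mk_triple k l).
Proof.
under [RHS]eq_bigr do rewrite pair_bigA.
rewrite (@sig_big_dep _ _ op _ (fun j => ('I_(p j) * 'I_(p j))%type : finType)
  xpredT (fun _ _ => true) (fun j kl => F (mk_triple kl.1 kl.2))).
by apply: eq_bigr => -[j [k l]].
Qed.

Lemma std_blocks_sum (b : blocks R p) :
  b = \sum_(u : triple p) b (tag u) (tagged u).1 (tagged u).2 *: std_blocks R u.
Proof.
rewrite big_triples /=.
apply/dsumP => i; rewrite dsum_sumE (bigD1 i) //= [X in _ + X]big1 ?addr0 => [|j ji].
  rewrite {1}[b i]matrix_sum_delta dsum_sumE; apply: eq_bigr => k _.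
  rewrite dsum_sumE; apply: eq_bigr => l _.
  by rewrite dsumZE mk_dsumE dfwith_in.
rewrite dsum_sumE big1 // => k _; rewrite dsum_sumE big1 // => l _.
by rewrite dsumZE mk_dsumE dfwith_out // scaler0.
Qed.

Lemma split_blocks_E (D : multi (triple p) n) :
  split_blocks R p n (E_blocks R n D) =
  mk_dsum (fun mu : multi 'I_t n =>
    if has_block_totals D mu then A_tensor R mu D else 0).
Proof.
exact: (lin_extE (b := fun D : multi (triple p) n => E_blocks R n D) _ D
  (free_E_blocks R p n)).
Qed.

End Blocks.

Theorem theorem8 (R : realType) (N s n t : nat) (p : 'I_t -> nat)
    (B : {vspace 'M[R[i]]_N}) (r : s.-tuple (subvs_of B))
    (phi : 'Hom(subvs_of B, blocks R p))
    (hn : (1 <= n)%N)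
    (hB : matrix_star_algebra B)
    (hr : basis_of {: subvs_of B} r)
    (hphi : block_diagonalization phi)
    (y : multi 'I_s n -> R[i]) :
  psi phi (\sum_(nu : multi 'I_s n) y nu *: sym_basis n (tnth r) nu) =
  mk_dsum (fun mu : multi 'I_t n =>
    \sum_(D : multi (triple p) n | has_block_totals D mu)
      (\sum_(nu : multi 'I_s n)
         y nu *
         (\prod_(j < t) \prod_(k < p j) \prod_(l < p j)
            (\sum_(i < s) phi (tnth r i) j k l *: 'X_i : {mpoly R[i][s]})
              ^+ block D (k, l))@_[multinom nu i | i < s]) *:
      A_tensor R mu D).
Proof.
rewrite /psi linear_sum linear_sum; apply/dsumP => mu.
rewrite dsum_sumE mk_dsumE.
transitivity (\sum_(nu : multi 'I_s n)
    \sum_(D : multi (triple p) n | has_block_totals D mu)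
   (y nu * (\prod_(j < t) \prod_(k < p j) \prod_(l < p j)
      (\sum_(i < s) phi (tnth r i) j k l *: 'X_i : {mpoly R[i][s]})
        ^+ block D (k, l))@_[multinom nu i | i < s]) *: A_tensor R mu D).
  apply: eq_bigr => nu _; rewrite !linearZ /= dsumZE.
  rewrite (Sym_map_basis _ _ (fun i => std_blocks_sum (phi (tnth r i)))).
  rewrite linear_sum dsum_sumE scaler_sumr [RHS]big_mkcond /=.
  apply: eq_bigr => D _; rewrite linearZ /= dsumZE split_blocks_E mk_dsumE.
  case: ifP => _; last by rewrite !scaler0.
  rewrite scalerA; congr ((_ * mcoeff _ _) *: _).
  exact: big_triples.
rewrite exchange_big; apply: eq_bigr => D _.
by rewrite scaler_suml.
Qed.
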